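(* Let $X$ be a Plichko space with a countably $1$-norming M-basis $\{x_\alpha\}_{\alpha<\theta}$, where $\theta$ is an uncountable cardinal. Then there exists an injective mapping $\phi\colon\theta\to\theta$ such that $\{x_{\phi(\alpha)}\}_{\alpha<\theta}$ forms a monotone basic sequence. Moreover, if $\theta$ is regular, then $\{\phi(\alpha)\}_{\alpha<\theta}$ can be taken to be an increasing sequence.
   Context: Banach spaces are real. $[A]$ is the closed linear span of $A$. An M-basis of $X$ is a family $\{x_\alpha\}_{\alpha<\theta}\subset X$ for which there are $x_\alpha^*\in X^*$ with $x^*_\alpha(x_\beta)=\delta_{\alpha,\beta}$, $[x_\alpha:\alpha<\theta]=X$ and $[x^*_\alpha:\alpha<\theta]$ weak-star dense in $X^*$. A subspace $Y\subset X^*$ is $1$-norming if $\|x\|=\sup\{f(x):f\in Y,\|f\|=1\}$ for all $x\in X$. The M-basis is countably $1$-norming if $\{f\in X^*:|\{\alpha:f(x_\alpha)\ne0\}|\le\aleph_0\}$ is a $1$-norming subspace of $X^*$; a Banach space is Plichko if it admits a countably $1$-norming M-basis. For a limit ordinal $\theta$, $\{y_\alpha\}_{\alpha<\theta}\subset X\setminus\{0\}$ is a monotone basic sequence if $\|y\|\le\|y+z\|$ for all $\lambda<\theta$, $y\in[y_\alpha:\alpha<\lambda]$, $z\in[y_\alpha:\lambda\le\alpha<\theta]$. *)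

(* Defs.v *)
From HB Require Import structures.
From mathcomp Require Import all_boot all_order all_algebra.
From mathcomp Require Import all_classical all_reals all_analysis.
Set Implicit Arguments.
Unset Strict Implicit.
Unset Printing Implicit Defensive.
Import Order.TTheory GRing.Theory Num.Theory.
Import numFieldNormedType.Exports.
Local Open Scope classical_set_scope.
Local Open Scope ring_scope.

(* An ordinal theta is represented by a well-founded total order [T]: the
   elements of [T] are the ordinals below theta, and a lambda < theta is an
   element of [T]. *)
Definition well_ordered (disp : Order.disp_t) (T : orderType disp) : Prop :=
  well_founded (fun a b : T => (a < b)%O).

(* theta is an initial ordinal: no smaller ordinal has its cardinality. *)
Definition is_cardinal (disp : Order.disp_t) (T : orderType disp) : Prop :=
  well_ordered T /\
  forall a : T, ~ ([set: T] #<= [set b : T | (b < a)%O])%card.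

Definition cofinal (disp : Order.disp_t) (T : orderType disp) (A : set T) :
    Prop :=
  forall b : T, exists2 a : T, A a & (b <= a)%O.

(* The cofinality of the (infinite) cardinal theta is theta. *)
Definition is_regular (disp : Order.disp_t) (T : orderType disp) : Prop :=
  forall A : set T, cofinal A -> ([set: T] #<= A)%card.

Definition lspan (R : realType) (V : lmodType R) (A : set V) : set V :=
  [set v | exists (n : nat) (c : 'I_n -> R) (a : 'I_n -> V),
     (forall i, A (a i)) /\ v = \sum_(i < n) c i *: a i].

Definition closed_span (R : realType) (X : normedModType R) (A : set X) :
    set X := closure (lspan A).

(* X^*, as a subset of the real vector space of all functions X -> R. *)
Definition dual (R : realType) (X : normedModType R) : set (X -> R^o) :=
  [set f | linear f /\ continuous f].
Arguments dual {R} X _.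

Definition dual_norm (R : realType) (X : normedModType R) (f : X -> R^o) : R :=
  sup [set `|f x| | x in [set x : X | `|x| <= 1]].

(* [closed_span] in X^*, whose topology is the one of [dual_norm]. *)
Definition dual_closed_span (R : realType) (X : normedModType R)
    (A : set (X -> R^o)) : set (X -> R^o) :=
  [set f | dual X f /\
     forall e : R, 0 < e -> exists2 g, lspan A g & dual_norm (f - g) < e].

(* The weak-star topology of X^* is induced by pointwise convergence. *)
Definition weak_star_dense (R : realType) (X : normedModType R)
    (A : set (X -> R^o)) : Prop :=
  dual X `<=` closure (A : set {ptws X -> R^o}).

Definition M_basis (R : realType) (X : normedModType R)
    (disp : Order.disp_t) (T : orderType disp) (x : T -> X) : Prop :=
  exists xs : T -> (X -> R^o),
    [/\ forall a, dual X (xs a),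
        forall a b, xs a (x b) = (a == b)%:R,
        closed_span (range x) = [set: X]
      & weak_star_dense (dual_closed_span (range xs))].

Definition dual_subspace (R : realType) (X : normedModType R)
    (Y : set (X -> R^o)) : Prop :=
  [/\ Y `<=` dual X, Y 0
    & forall (c : R) (f g : X -> R^o), Y f -> Y g -> Y (c *: f + g)].

Definition one_norming (R : realType) (X : normedModType R)
    (Y : set (X -> R^o)) : Prop :=
  dual_subspace Y /\
  forall x : X, `|x| = sup [set f x | f in [set f | Y f /\ dual_norm f = 1]].

Definition countably_one_norming (R : realType) (X : normedModType R)
    (disp : Order.disp_t) (T : orderType disp) (x : T -> X) : Prop :=
  one_norming
    [set f : X -> R^o | dual X f /\ countable [set a : T | f (x a) != 0]].

Definition monotone_basic_sequence (R : realType) (X : normedModType R)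
    (disp : Order.disp_t) (T : orderType disp) (y : T -> X) : Prop :=
  (forall a, y a != 0) /\
  forall (l : T) (u v : X),
    closed_span [set y a | a in [set a : T | (a < l)%O]] u ->
    closed_span [set y a | a in [set a : T | (l <= a)%O]] v ->
    `|u| <= `|u + v|.

(* Main.v *)
Require Import Defs.
From HB Require Import structures.
From mathcomp Require Import all_boot all_order all_algebra.
From mathcomp Require Import all_classical all_reals all_analysis.
From mathcomp Require Import lra.
Set Implicit Arguments.
Unset Strict Implicit.
Unset Printing Implicit Defensive.
Import Order.TTheory GRing.Theory Num.Theory.
Import numFieldNormedType.Exports.
Local Open Scope classical_set_scope.
Local Open Scope ring_scope.

(* Finite rational combinations of the [x a] are dense in their closed span, and
   each is normed by countably many functionals of countable support.  So for a
   set of indices [A] there is a set [bad A], of cardinality at most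
   [max(|A|, aleph_0)], off which the indices [c] satisfy: the functionals
   norming the closed span of [x @` A] vanish at [x c].  By transfinite recursion
   choose [phi a] outside [bad {phi b | b < a}], which is smaller than theta; in
   the regular case it is not even cofinal, so [phi a] can be taken above it.
   If [u] is in the span of the terms below [l] and [v] in the span of the
   others, a functional [f] of norm 1 with [f u] close to [|u|] kills [v], whence
   [|u| <= |u + v|]. *)

(** * Injections, well-founded recursion and cardinal arithmetic *)

Lemma inj_on_card_le (T U : Type) (A : set T) (B : set U) (f : T -> U) :
  (forall x, A x -> B (f x)) ->
  (forall x y, A x -> A y -> f x = f y -> x = y) -> (A #<= B)%card.
Proof.
move=> fAB finj.
have AfB : f @` A `<=` B by move=> _ [x Ax <-]; exact: fAB.
apply: card_le_trans (subset_card_le AfB).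
have injf : {in A &, injective f}.
  by move=> x y /set_mem Ax /set_mem Ay; exact: finj.
by have /card_eqPle[] := inj_card_eq injf.
Qed.

Lemma card_le_inj_on (T U : Type) (u0 : U) (A : set T) (B : set U) :
  (A #<= B)%card -> exists f : T -> U,
    (forall x, A x -> B (f x)) /\
    (forall x y, A x -> A y -> f x = f y -> x = y).
Proof.
move=> /card_leP[g].
pose f x := if pselect (A x) is left Ax then val (g (SigSub (mem_set Ax)))
            else u0.
exists f; split=> [x Ax|x y Ax Ay]; rewrite /f.
  by case: pselect => // ?; exact: set_mem (valP _).
case: pselect => // Ax'; case: pselect => // Ay' /val_inj.
by move/(@inj _ _ _ g); rewrite !inE => /(_ I I) [].
Qed.

Lemma card_leX (T U T' U' : Type) (A : set T) (B : set U)
    (A' : set T') (B' : set U') :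
  (A #<= A')%card -> (B #<= B')%card -> (A `*` B #<= A' `*` B')%card.
Proof.
move=> AA' BB'.
have [->|/set0P[[a b] [/= Aa Bb]]] := eqVneq (A `*` B) set0.
  exact: card_ge0.
have [a' _] : A' !=set0.
  apply/set0P/eqP => A0; move: AA'; rewrite A0 => /card_le0P A0'.
  by rewrite A0' in Aa.
have [b' _] : B' !=set0.
  apply/set0P/eqP => B0; move: BB'; rewrite B0 => /card_le0P B0'.
  by rewrite B0' in Bb.
have [f [fA finj]] := card_le_inj_on a' AA'.
have [g [gB ginj]] := card_le_inj_on b' BB'.
apply: (@inj_on_card_le _ _ _ _ (fun p => (f p.1, g p.2))).
  by move=> [x y] [/= Ax By]; split; [exact: fA|exact: gB].
move=> [x y] [x' y'] [/= Ax By] [/= Ax' By'] [/finj -> // /ginj -> //].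
Qed.

(** Recursion in which each choice sees only the set of values chosen before. It serves both the
    square of a segment and the construction of [phi]. *)
Lemma wf_choice (T U : Type) (r : T -> T -> Prop) (u0 : U)
    (Q : T -> set U -> U -> Prop) :
  well_founded r ->
  (forall a (f : T -> U), exists u, Q a (f @` [set b | r b a]) u) ->
  exists f : T -> U, forall a, Q a (f @` [set b | r b a]) (f a).
Proof.
move=> wfr exQ.
(* The partial function on the predecessors is made total by the default [u0], which leaves its
   image of the predecessors unchanged. *)
pose ext a (g : forall b, r b a -> U) b :=
  if pselect (r b a) is left h then g b h else u0.
pose F a g := sval (cid (exQ a (ext a g))).
have FE a : Fix wfr (fun=> U) F a = F a (fun b _ => Fix wfr (fun=> U) F b).
  apply: Fix_eq => b f g fg; congr F.
  by apply: functional_extensionality_dep => c; apply: funext => h.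
exists (Fix wfr (fun=> U) F) => a.
rewrite [X in Q _ _ X]FE /F; case: cid => u /=.
suff -> : ext a (fun b _ => Fix wfr (fun=> U) F b) @` [set b | r b a] =
          Fix wfr (fun=> U) F @` [set b | r b a] by [].
by apply: eq_imagel => b /= rba; rewrite /ext; case: pselect.
Qed.

Lemma wf_lex (A B C : Type) (ra : A -> A -> Prop) (rb : B -> B -> Prop)
    (f : C -> A) (g : C -> B) :
  well_founded ra -> well_founded rb ->
  well_founded (fun c d => ra (f c) (f d) \/ f c = f d /\ rb (g c) (g d)).
Proof.
move=> wfa wfb c.
have [a] : exists a, f c = a by exists (f c).
elim/(well_founded_ind wfa): a c => a IHa c.
have [b] : exists b, g c = b by exists (g c).
elim/(well_founded_ind wfb): b c => b IHb c gc fc.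
constructor=> d [|[fd]]; first by rewrite fc => /IHa; apply.
by rewrite gc => /IHb; apply => //; rewrite fd.
Qed.

(** Hessenberg's theorem (an infinite cardinal equals its square), by induction on segments. *)
Lemma segment_square (disp : Order.disp_t) (T : orderType disp) (a : T) :
  well_ordered T -> let I := [set b : T | (b < a)%O] in
  infinite_set I -> (I `*` I #<= I)%card.
Proof.
move=> wo /=; elim/(well_founded_ind wo): a => a IH infa.
set I := fun a : T => [set b : T | (b < a)%O].
have [[b /= ba ab]|small] :=
  pselect (exists2 b, (b < a)%O & (I a #<= I b)%card).
  have infb : infinite_set (I b) by move=> /(card_le_finite ab).
  apply: card_le_trans (card_leX ab ab) _.
  apply: card_le_trans (IH _ ba infb) _.
  by apply: subset_card_le => c /lt_trans; exact.
(* [I a] is now an initial ordinal.  Well-order the pairs by their maximum, then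
   lexicographically: every proper segment is smaller than [I a], so sending each
   pair to an element of [I a] not used earlier never gets stuck. *)
pose lex (p q : T * T) := (p.1 < q.1)%O \/ p.1 = q.1 /\ (p.2 < q.2)%O.
pose m (p : T * T) := Order.max p.1 p.2.
pose r (p q : T * T) := (m p < m q)%O \/ m p = m q /\ lex p q.
have wfr : well_founded r := wf_lex m id wo (wf_lex fst snd wo wo).
have rtot p q : p <> q -> r p q \/ r q p.
  case: p q => [p1 p2] [q1 q2] pq; rewrite /r /lex /=.
  case: (ltgtP (m (p1, p2)) (m (q1, q2))) => mpq.
  - by left; left.
  - by right; left.
  case: (ltgtP p1 q1) => pq1; first by left; right; split=> //; left.
    by right; right; split=> //; left.
  case: (ltgtP p2 q2) => pq2; first by left; right; split=> //; right.
    by right; right; split=> //; right.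
  by case: pq; rewrite pq1 pq2.
have [g gP] : exists g : T * T -> T, forall p, (I a `*` I a) p ->
    I a (g p) /\ ~ (g @` [set q | r q p]) (g p).
  pose Q (p : T * T) (B : set T) u := (I a `*` I a) p -> I a u /\ ~ B u.
  apply: (@wf_choice _ _ r a Q wfr) => p f.
  have [Ip|nIp] := pselect ((I a `*` I a) p); last by exists a => /nIp.
  suff /existsNP[u /not_implyP[Iu nBu]] : ~ (I a `<=` f @` [set q | r q p]).
    by exists u.
  (* If all of [I a] were used before [p], it would inject into the square of [J], since pairs
     preceding [p] have coordinates at most [m p]. *)
  move=> IaB; have ma : (m p < a)%O by rewrite /m gt_max; case: Ip => /= -> ->.
  pose J := [set b | (b <= m p)%O].
  have IaJ : (I a #<= J `*` J)%card.
    apply: card_le_trans (subset_card_le IaB) _.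
    apply: card_le_trans (card_image_le _ _) _.
    apply: subset_card_le => q rqp.
    have : (m q <= m p)%O by case: rqp => [/ltW|[->]].
    by rewrite /m ge_max => /andP[].
  have JE : J = I (m p) `|` [set m p].
    by apply/seteqP; split=> c; rewrite /J /I /= le_eqVlt;
      [case/orP=> [/eqP ->|]; [right|left]|case=> [->|->]; rewrite ?eqxx ?orbT].
  have [finm|infm] := pselect (finite_set (I (m p))).
    have finJ : finite_set J by rewrite JE finite_setU.
    by apply: infa; exact: card_le_finite IaJ (finite_setX finJ finJ).
  have [c0 Ic0] := infinite_setN0 infm.
  have [c1 [Ic1 c10]] : exists c1, I (m p) c1 /\ c1 <> c0.
    apply: contrapT => nc; apply: infm.
    apply: sub_finite_set (finite_set1 c0) => c Ic.
    by apply: contrapT => cc0; apply: nc; exists c.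
  (* The endpoint [m p] goes to [(c1, c0)] and any other [b] to [(c0, b)]; these differ because
     [c1 <> c0], and [IH] shrinks the square. *)
  have JI : (J #<= I (m p))%card.
    apply: card_le_trans (IH _ ma infm).
    apply: (@inj_on_card_le _ _ _ _
      (fun b => if b == m p then (c1, c0) else (c0, b))).
      move=> b; rewrite /J /= le_eqVlt.
      by case: eqP => [_|_ /= bm]; split.
    move=> b c; rewrite /J /= => _ _.
    by case: eqP => [->|_]; case: eqP => [->|_] // [] // /esym.
  apply: small; exists (m p) => //.
  apply: card_le_trans IaJ _; apply: card_le_trans (card_leX JI JI) _.
  exact: IH.
apply: (@inj_on_card_le _ _ _ _ g); first by move=> p /gP[].
move=> p q Ip Iq gpq; apply: contrapT => /rtot[rpq|rqp].
  by case: (gP q Iq) => _; apply; exists p.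
by case: (gP p Ip) => _; apply; exists q.
Qed.

(** Iterated pairing need not separate lists of different lengths, so the length, embedded in [A] by
    [e], is paired with the code. *)
Lemma card_seq_le (T : eqType) (A : set T) :
  infinite_set A -> (A `*` A #<= A)%card ->
  ([set s : seq T | [set` s] `<=` A] #<= A)%card.
Proof.
move=> infA A2; have [t0 At0] := infinite_setN0 infA.
have [p [pA pinj]] := card_le_inj_on t0 A2.
have /infiniteP/(card_le_inj_on t0)[e [eA einj]] := infA.
pose code := foldr (fun t c => p (t, c)) t0.
have codeA s : [set` s] `<=` A -> A (code s).
  elim: s => //= t s IHs sA; apply: pA; split=> /=.
    by apply: sA; rewrite /= mem_head.
  by apply: IHs => u us; apply: sA; rewrite /= inE us orbT.
have code_inj s s' : size s = size s' -> [set` s] `<=` A -> [set` s'] `<=` A ->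
    code s = code s' -> s = s'.
  elim: s s' => [|t s IHs] [|t' s'] //= [sz] sA sA' cs.
  have [At At'] : A t /\ A t'.
    by split; [apply: sA|apply: sA']; rewrite /= mem_head.
  have ssA : [set` s] `<=` A by move=> u us; apply: sA; rewrite /= inE us orbT.
  have ssA' : [set` s'] `<=` A.
    by move=> u us; apply: sA'; rewrite /= inE us orbT.
  have Ap : (A `*` A) (t, code s) by split=> //; exact: codeA.
  have Ap' : (A `*` A) (t', code s') by split=> //; exact: codeA.
  by have [-> /(IHs s' sz ssA ssA') ->] := pinj _ _ Ap Ap' cs.
apply: (@inj_on_card_le _ _ _ _ (fun s => p (e (size s), code s))) => [s sA|].
  by apply: pA; split=> /=; [exact: eA|exact: codeA].
move=> s s' sA sA' pss'.
have pairA u : [set` u] `<=` A -> (A `*` A) (e (size u), code u).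
  by move=> uA; split; [exact: eA|exact: codeA].
have [/einj sz cs] := pinj _ _ (pairA _ sA) (pairA _ sA') pss'.
by apply: code_inj => //; exact: sz.
Qed.

Lemma card_bigcup_countable (I U : Type) (A : set I) (F : I -> set U) :
  (forall i, A i -> countable (F i)) ->
  (\bigcup_(i in A) F i #<= A `*` [set: nat])%card.
Proof.
move=> cF.
have [->|/set0P[u0 _]] := eqVneq (\bigcup_(i in A) F i) set0.
  exact: card_ge0.
have /choice[g gP] : forall i, exists g : nat -> U, A i -> F i `<=` range g.
  move=> i; have [/cF/(card_le_inj_on 0%N)[h [_ hinj]]|] := pselect (A i);
    last by exists (fun=> u0).
  (* A left inverse of the injection [h], with default [u0], enumerates [F i]. *)
  exists (fun n => if pselect (exists u, F i u /\ h u = n) is left ex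
                   then sval (cid ex) else u0) => _ u Fu.
  exists (h u) => //; case: pselect => [ex|[]]; last by exists u.
  by case: cid => /= v [Fv huv]; exact: hinj.
have sub : \bigcup_(i in A) F i `<=`
    (fun p => g p.1 p.2) @` (A `*` [set: nat]).
  by move=> u [i Ai /(gP i Ai)[n _ <-]]; exists (i, n).
exact: card_le_trans (subset_card_le sub) (card_image_le _ _).
Qed.

Lemma countable_seqs (T : eqType) (A : set T) :
  countable A -> countable [set s : seq T | [set` s] `<=` A].
Proof.
move=> /(card_le_inj_on 0%N)[h [_ hinj]].
apply: (@sub_countable _ _ _ [set: seq nat]); last exact: countableP.
apply: (@inj_on_card_le _ _ _ _ (map h)) => // s s' sA sA' /= ss'.
elim: s s' sA sA' ss' => [|t s IHs] [|t' s'] //= sA sA' [htt' ss'].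
congr cons; last first.
  apply: IHs => // u us; [apply: sA|apply: sA'];
  by rewrite /= inE us orbT.
by apply: hinj => //; [apply: sA|apply: sA']; rewrite /= mem_head.
Qed.

(** Lists over the image lift to lists over the segment below [a]. If that segment is countable, so
    is the union; otherwise it absorbs both finite lists and a countable factor, and it is smaller
    than [T]. *)
Lemma card_bigcup_seqs_lt (disp : Order.disp_t) (T : orderType disp)
    (U : eqType) (F : seq U -> set T) (phi : T -> U) (a : T) :
  is_cardinal T -> ~ countable [set: T] -> (forall s, countable (F s)) ->
  let A := phi @` [set b | (b < a)%O] in
  ~ ([set: T] #<= \bigcup_(s in [set s : seq U | [set` s] `<=` A]) F s)%card.
Proof.
move=> [wo card] unc cF /=; set I := [set b | (b < a)%O].
set S := [set s : seq T | [set` s] `<=` I].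
have sub : \bigcup_(s in [set s : seq U | [set` s] `<=` phi @` I]) F s `<=`
           \bigcup_(s in S) F (map phi s).
  move=> t [s sA Fst].
  suff [s' s'I sE] : exists2 s', S s' & s = map phi s'.
    by exists s' => //=; rewrite -sE.
  elim: s sA {Fst} => [|u s IHs] sA; first by exists [::].
  have [|s' s'I ->] := IHs.
    by move=> v vs; apply: sA; rewrite /= inE vs orbT.
  have [|b bI <-] := sA u; first by rewrite /= mem_head.
  by exists (b :: s') => // c /=; rewrite inE => /orP[/eqP ->//|]; exact: s'I.
move=> le; have {}le := card_le_trans le (subset_card_le sub).
have [cI|ncI] := pselect (countable I).
  apply/unc/(sub_countable le)/bigcup_countable; first exact: countable_seqs.
  by move=> s _; exact: cF.
have infI : infinite_set I by move=> /finite_set_countable.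
have I2 : (I `*` I #<= I)%card := segment_square wo infI.
apply: (card a); apply: card_le_trans le _.
apply: card_le_trans (card_bigcup_countable _) _ => //.
apply: card_le_trans (I2).
by apply: card_leX; [exact: card_seq_le infI I2|exact/infiniteP].
Qed.

(** * Norming functionals and rational approximation *)

Section LinearFunctional.
Variables (R : realType) (X : normedModType R) (f : X -> R^o).
Hypothesis f_lin : linear f.

Lemma linear_funD u v : f (u + v) = f u + f v.
Proof. by rewrite -[u]scale1r f_lin !scale1r. Qed.

Lemma linear_fun0 : f 0 = 0.
Proof. by apply: (addIr (f 0)); rewrite -linear_funD !add0r. Qed.

Lemma linear_funZ a u : f (a *: u) = a * f u.
Proof. by rewrite -[a *: u]addr0 f_lin linear_fun0 !addr0. Qed.

Lemma linear_fun_sum_eq0 n (c : 'I_n -> R) (a : 'I_n -> X) :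
  (forall i, f (a i) = 0) -> f (\sum_(i < n) c i *: a i) = 0.
Proof.
move=> fa0; elim/big_ind: _ => [|u v fu fv|i _]; first exact: linear_fun0.
  by rewrite linear_funD fu fv addr0.
by rewrite linear_funZ fa0 mulr0.
Qed.

Lemma dual_norm_eq1_le u : dual_norm f = 1 -> `|f u| <= `|u|.
Proof.
move=> f1.
have [->|u0] := eqVneq u 0; first by rewrite linear_fun0 !normr0.
have nu : 0 < `|u| by rewrite normr_gt0.
set E := [set `|f z| | z in [set z : X | `|z| <= 1]].
(* [sup] is 0 on a set without supremum, so the value 1 forces boundedness. *)
have Esup : has_sup E.
  by apply: contrapT => /sup_out; rewrite -/(dual_norm f) f1 => /eqP;
    rewrite oner_eq0.
suff : `|f (`|u|^-1 *: u)| <= 1.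
  by rewrite linear_funZ normrM normfV normr_id ler_pdivrMl // mulr1.
rewrite -f1; apply: (ub_le_sup Esup.2); exists (`|u|^-1 *: u) => //=.
by rewrite normrZ normfV normr_id mulVf // gt_eqF.
Qed.

End LinearFunctional.

Lemma norming_functional (R : realType) (X : normedModType R)
    (Y : set (X -> R^o)) (w : X) (e : R) :
  one_norming Y -> 0 < e ->
  exists f, [/\ Y f, forall z, `|f z| <= `|z| & `|w| - e < f w].
Proof.
move=> [[Ydual Y0 _] norming] e0.
set E := [set f w | f in [set f | Y f /\ dual_norm f = 1]].
have wE : `|w| = sup E := norming w.
have [/(sup_adherent e0)[_ [f [Yf f1] <-]]|/sup_out E0] := pselect (has_sup E).
  rewrite -wE => wf; exists f; split=> // z.
  by apply: dual_norm_eq1_le f1; have [] := Ydual f Yf.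
(* Without a supremum, the convention [sup E = 0] gives [w] norm 0, and the zero functional will
   do. *)
exists 0; split=> [//|z|]; first by rewrite normr0.
by rewrite wE E0 sub0r oppr_lt0.
Qed.

Lemma closure_approx (R : realType) (X : normedModType R) (A : set X) (u : X)
    (e : R) : closure A u -> 0 < e -> exists2 w, A w & `|u - w| < e.
Proof.
move=> Au e0; have [w [Aw]] := Au _ (nbhsx_ballx u e e0).
by rewrite -ball_normE /= => uw; exists w.
Qed.

(** Coefficients and indices form separate lists, so that each index list carries only countably
    many combinations. *)
Definition rat_comb (R : realType) (V : lmodType R) (T : Type) (x : T -> V)
    (q : seq rat) (s : seq T) : V :=
  \sum_(p <- zip q s) ratr p.1 *: x p.2.

Lemma rat_comb_approx (R : realType) (X : normedModType R) (T : eqType)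
    (x : T -> X) (A : set T) (u : X) (e : R) :
  closed_span (x @` A) u -> 0 < e ->
  exists q s, [set` s] `<=` A /\ `|u - rat_comb x q s| < e.
Proof.
move=> Au e0; have e20 : 0 < e / 2 by rewrite divr_gt0.
have [_ [n [c [a [aA ->]]]] ue] := closure_approx Au e20.
suff [q [s [sA we]]] : exists q s, [set` s] `<=` A /\
    `|\sum_(i < n) c i *: a i - rat_comb x q s| < e / 2.
  exists q, s; split=> //; rewrite [e]splitr.
  rewrite -(subrKA (\sum_(i < n) c i *: a i)).
  by apply: le_lt_trans (ler_normD _ _) _; exact: ltrD.
elim: n c a aA (e / 2) e20 {ue} => [|n IHn] c a aA d d0.
  exists [::], [::]; split=> [t|]; first by rewrite /= in_nil.
  by rewrite big_ord0 /rat_comb big_nil subrr normr0.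
have d20 : 0 < d / 2 by rewrite divr_gt0.
have [q [s [sA qs]]] := IHn (c \o lift ord0) (a \o lift ord0)
  (fun i => aA (lift ord0 i)) (d / 2) d20.
have [t At xt] := aA ord0.
(* A coefficient error below [k] costs less than [d / 2]; the [+ 1] covers [x t = 0]. *)
pose k := d / 2 / (`|x t| + 1).
have k0 : 0 < k by rewrite divr_gt0 // ltr_wpDl.
have [r /[!in_itv]/= /andP[cr rc]] :
    exists r : rat, ratr r \in `]c ord0, c ord0 + k[.
  by apply: rat_in_itvoo; rewrite ltrDl.
exists (r :: q), (t :: s); split.
  by move=> z /=; rewrite inE => /orP[/eqP ->//|]; exact: sA.
rewrite big_ord_recl /rat_comb /= big_cons /= -xt opprD addrACA -scalerBl.
rewrite [d]splitr; apply: le_lt_trans (ler_normD _ _) _; apply: ltrD => //.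
rewrite normrZ distrC gtr0_norm ?subr_gt0 //.
have {}rc : ratr r - c ord0 < k by rewrite ltrBlDl.
apply: (@le_lt_trans _ _ (k * `|x t|)).
  by rewrite ler_wpM2r // ltW.
by rewrite /k mulrAC ltr_pdivrMr ?ltr_wpDl // ltr_pM2l // ltrDl.
Qed.

(* [F s] collects the supports of countably many functionals norming the span
   of [x] over [s]; vectors indexed outside these supports are annihilated. *)
Lemma countable_obstruction (R : realType) (X : normedModType R)
    (disp : Order.disp_t) (T : orderType disp) (x : T -> X) :
  countably_one_norming x ->
  exists F : seq T -> set T, (forall s, countable (F s)) /\
    forall (A C : set T) (u v : X),
      closed_span (x @` A) u -> closed_span (x @` C) v ->
      (forall c, C c -> ~ (\bigcup_(s in [set s | [set` s] `<=` A]) F s) c) ->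
      `|u| <= `|u + v|.
Proof.
move=> norming.
have /choice[f fP] : forall i : seq T * (seq rat * nat), exists f : X -> R^o,
    [/\ dual X f /\ countable [set a : T | f (x a) != 0],
        forall z, `|f z| <= `|z|
      & `|rat_comb x i.2.1 i.1| - i.2.2.+1%:R^-1 < f (rat_comb x i.2.1 i.1)].
  by move=> i; exact: norming_functional norming _.
exists (fun s => \bigcup_j [set a | f (s, j) (x a) != 0]); split.
  move=> s; apply: bigcup_countable; first exact: countableP.
  by move=> j _; have [[]] := fP (s, j).
move=> A C u v Au Cv AC; rewrite leNgt; apply/negP => uv.
(* Three errors below [e] arise: [|u - w|] twice, once in norm and once under [g], and the defect of
   [g] at [w]. *)
pose e := (`|u| - `|u + v|) / 3.
have e0 : 0 < e by rewrite divr_gt0 // subr_gt0.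
have [q [s [sA uw]]] := rat_comb_approx Au e0.
have [n _ /(_ n (leqnn n))/= ne] := near_infty_natSinv_lt (PosNum e0).
have [[[flin _] _] fle fw] := fP (s, (q, n)).
set g := f _ in flin fle fw; set w := rat_comb x q s in uw fw.
(* [g] kills each [x t] with [t] in [C], hence their span, and [fle] carries this to the closure. *)
have gv : g v = 0.
  apply/eqP; rewrite -normr_le0; apply/ler_addgt0Pr => d d0; rewrite add0r.
  have [_ [k [c [a [aC ->]]]] vd] := closure_approx Cv d0.
  have <- : g (v - \sum_(i < k) c i *: a i) = g v.
    rewrite -scaleN1r addrC flin linear_fun_sum_eq0 ?scaler0 ?add0r // => i.
    have [t Ct <-] := aC i; apply: contrapT => gt; apply: (AC t Ct).
    by exists s => //; exists (q, n) => //; exact/eqP.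
  exact: ltW (le_lt_trans (fle _) vd).
have guv : g (u + v) = g w + g (u - w).
  by rewrite linear_funD // gv addr0 -linear_funD // [w + _]addrC subrK.
have h1 : g (u + v) <= `|u + v| := le_trans (ler_norm _) (fle _).
have h2 : - `|u - w| <= g (u - w).
  by rewrite lerNl; apply: le_trans (fle _); rewrite -normrN ler_norm.
have h3 : `|u| <= `|w| + `|u - w|.
  by rewrite -{1}[u](subrK w) addrC; exact: ler_normD.
rewrite guv in h1; rewrite /= -/w in fw.
have eE : e * 3 = `|u| - `|u + v| by rewrite mulfVK.
have arith (a b c d y k l m : R) : m < k -> c < k -> - c <= y -> a <= d + c ->
    l + y <= b -> d - m < l -> k * 3 = a - b -> False by lra.
exact: arith ne uw h2 h3 h1 fw eE.
Qed.

Theorem theorem3p7 (R : realType) (X : completeNormedModType R)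
    (disp : Order.disp_t) (theta : orderType disp) (x : theta -> X) :
  is_cardinal theta ->
  ~ countable [set: theta] ->
  M_basis x ->
  countably_one_norming x ->
  (exists phi : theta -> theta,
     injective phi /\ monotone_basic_sequence (x \o phi)) /\
  (is_regular theta ->
   exists phi : theta -> theta,
     [/\ injective phi,
         {homo phi : a b / (a < b)%O}
       & monotone_basic_sequence (x \o phi)]).
Proof.
move=> card unc [xs [xs_dual xs_x _ _]] /countable_obstruction[F [cF FP]].
(* Adding the entries of [s] puts [A] inside [bad A]: avoiding it yields injectivity, and exceeding
   it yields monotonicity of [phi]. *)
pose bad A := \bigcup_(s in [set s | [set` s] `<=` A]) (F s `|` [set` s]).
have bad_small (phi : theta -> theta) a :
    ~ ([set: theta] #<= bad (phi @` [set b | (b < a)%O]))%card.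
  have := @card_bigcup_seqs_lt _ _ _ (fun s => F s `|` [set` s]) phi a card unc.
  apply=> s; rewrite -bigcup2E; apply: bigcup_countable; first exact: countableP.
  by move=> [|[|n]] _ //=; exact/finite_set_countable/finite_seq.
have bad_id A : A `<=` bad A.
  move=> b Ab; exists [:: b]; last by right; rewrite /= mem_head.
  by move=> c /=; rewrite inE => /eqP ->.
have [t0 _] : [set: theta] !=set0.
  by apply/set0P/eqP => T0; apply: unc; rewrite T0.
have key (phi : theta -> theta) :
    (forall a, ~ bad (phi @` [set b | (b < a)%O]) (phi a)) ->
    injective phi /\ monotone_basic_sequence (x \o phi).
  move=> good; split.
    move=> a b ab; apply: contrapT => /eqP; rewrite neq_lt => /orP[lt|lt].
      by apply: (good b); apply: bad_id; exists a.
    by apply: (good a); apply: bad_id; exists b.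
  split=> [a|l u v lu lv].
    apply/eqP => /= xa0; have := xs_x (phi a) (phi a).
    have [xs_lin _] := xs_dual (phi a).
    by rewrite xa0 linear_fun0 // eqxx => /esym/eqP; rewrite oner_eq0.
  (* For [l <= b], lists over the values below [l] are also lists over the values below [b], which
     [phi b] avoids. *)
  have := FP (phi @` [set a | (a < l)%O]) (phi @` [set a | (l <= a)%O]) u v.
  rewrite !image_comp => /(_ lu lv); apply=> _ [b /= lb <-] [s sl Fb].
  apply: (good b); exists s; last by left.
  apply: subset_trans sl _ => _ [c /= cl <-]; exists c => //.
  exact: lt_le_trans cl lb.
split.
  have [||phi /key] := @wf_choice theta theta (fun a b => (a < b)%O) t0
    (fun _ B u => ~ bad B u); [exact: card.1| |by exists phi].
  move=> a phi; apply: contrapT => /forallNP all_bad; apply: (bad_small phi a).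
  by apply: subset_card_le => c _; apply: contrapT; exact: all_bad.
move=> reg.
have [||phi phiP] := @wf_choice theta theta (fun a b => (a < b)%O) t0
  (fun _ B u => forall c, bad B c -> (c < u)%O); first exact: card.1.
  move=> a phi; apply: contrapT => /forallNP no_bound.
  (* Without a strict upper bound the bad set would be cofinal, hence by regularity as large as
     [theta]. *)
  apply: (bad_small phi a); apply: reg => b.
  apply: contrapT => nb; apply: (no_bound b) => c bad_c; rewrite ltNge.
  by apply/negP => bc; apply: nb; exists c.
have [|phi_inj phi_mon] := key phi; first by move=> a /phiP; rewrite ltxx.
exists phi; split=> // a b ab.
by apply: phiP; apply: bad_id; exists a.
Qed.
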